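(* The Hilbert series of the coordinate ring of the cone of ${\mathrm{O}}(4)$ is \[\mathrm{H}(\mathcal{O}(\mathcal{C}({\mathrm{O}}(4)));t)=\frac{1+9t+27t^2+19t^3-30t^4+34t^5-35t^6+21t^7-7t^8+t^9}{(1-t)^7}.\] Equivalently, $\dim_{\mathbb{C}}\mathcal{O}(\mathcal{C}({\mathrm{O}}(4)))_d=p(d)$ for $d\ne 2$ and $=p(2)-1=118$ for $d=2$, where $p(d)=\frac{1}{18}d^6+\frac23d^5+\frac{20}{9}d^4+4d^3+\frac{85}{18}d^2+\frac{10}{3}d+1$.
   Context: ${\mathrm{O}}(4)=\{M\in\mathbb{C}^{4\times4}\mid M^TM=I\}$. The cone $\mathcal{C}({\mathrm{O}}(4))$ is the Zariski closure in $\mathbb{C}^{4\times 4}$ of $\{cM\mid c\in\mathbb{C},M\in{\mathrm{O}}(4)\}$; its coordinate ring is the quotient of the standard graded polynomial ring $\mathbb{C}[x_{ij}\mid 1\le i,j\le 4]$ by the homogeneous vanishing ideal, with induced grading and degree $d$ component $\mathcal{O}(\mathcal{C}({\mathrm{O}}(4)))_d$. The Hilbert series of a graded algebra $A=\bigoplus_dA_d$ is $\sum_d\dim_{\mathbb{C}}(A_d)t^d$. *)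

(* Defs.v *)
From HB Require Import structures.
From mathcomp Require Import all_boot all_algebra.
From mathcomp Require Import complex.
From mathcomp Require Import Rstruct.
From mathcomp Require Import mpoly.
Set Implicit Arguments. Unset Strict Implicit. Unset Printing Implicit Defensive.
Import GRing.Theory Num.Theory.
Local Open Scope ring_scope.

Definition CC : closedFieldType := (Rdefinitions.R)[i].

(* The standard graded polynomial ring C[x_ij | 1 <= i,j <= 4]:
   16 variables, variable k : 'I_16 corresponds to the entry of index k
   of mxvec (row-major flattening of a 4x4 matrix). *)
Definition Pol := {mpoly CC[16]}.

Definition mxpt (M : 'M[CC]_4) : 'I_16 -> CC := fun k => mxvec M 0 k.

Definition inO4 (M : 'M[CC]_4) : Prop := M^T *m M = 1%:M.

(* p vanishes on the cone { c M | c in C, M in O(4) } (equivalently on its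
   Zariski closure C(O(4))). *)
Definition vanishes_on_cone (p : Pol) : Prop :=
  forall (c : CC) (M : 'M[CC]_4), inO4 M -> p.@[mxpt (c *: M)] = 0.

(* ps_0..ps_(n-1) are homogeneous of degree d and their classes in the
   degree-d component O(C(O(4)))_d = C[x]_d / I_d are linearly independent,
   where I_d is the degree-d part of the homogeneous vanishing ideal. *)
Definition indep_mod_I (d n : nat) (ps : 'I_n -> Pol) : Prop :=
  (forall i, ps i \is d.-homog) /\
  (forall a : 'I_n -> CC,
      vanishes_on_cone (\sum_(i < n) a i *: ps i) -> forall i, a i = 0).

Definition dim_component (d N : nat) : Prop :=
  (exists ps : 'I_N -> Pol, indep_mod_I d ps) /\
  (forall ps : 'I_N.+1 -> Pol, ~ indep_mod_I d ps).

Definition hilb_numer : seq int :=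
  [:: 1; 9; 27; 19; -30; 34; -35; 21; -7; 1]%Z.

(* Coefficient of t^d in (1-t)^7 * (sum_d h d t^d). *)
Definition times_1mt7 (h : nat -> nat) (d : nat) : int :=
  \sum_(k < (minn 7 d).+1) ((-1) ^+ k * ('C(7, k))%:Z * (h (d - k)%N)%:Z).

(* Main.v *)
(* In coordinates z = U x in which the quadratic form x.x becomes the determinant
   of the 2x2 matrix (z_ab), a 4x4 matrix is a tensor Z_(ab)(ce). Conformal
   matrices of the determinant have the form P_ac Q_be or P_ae Q_bc, and
   conversely every such tensor with P, Q invertible is conformal, so the closure
   of the cone is the union of two Segre cones P^3 x P^3. A word of d letters in
   {0,1}^4 is a monomial of degree d in the Z_(ab)(ce); on the two Segre cones it
   restricts to the monomials recorded by the multisets of its (ac) and (be)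
   letters, respectively of its (ae) and (bc) letters. The Hilbert function is
   thus the rank of the incidence matrix of a bipartite graph with 'C(d + 3, 3)^2
   vertices on each side, that is, the number of vertices minus the number of
   connected components. Let S_d^4 act on quadruples (a, b, c, e) of boolean
   words: a component is an orbit of the subgroup of elements of total sign +1.
   When some word has a repeated letter, which is always the case for d <> 0, 1, 2
   and irrelevant for d = 0, 1, its orbit is determined by the numbers of ones in
   a, b, c, e; this gives (d + 1)^4 components. For d = 2 the quadruples without
   a repeated letter in any word split into two orbits instead of one. *)
Require Import Defs.
From HB Require Import structures.
From mathcomp Require Import all_boot all_fingroup all_algebra.
From mathcomp Require Import complex.
From mathcomp Require Import Rstruct.
From mathcomp Require Import mpoly.
From mathcomp Require Import zify ring.
Set Implicit Arguments. Unset Strict Implicit. Unset Printing Implicit Defensive.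
Import GRing.Theory Num.Theory.

(** * Permutations of the positions of a word *)

Section Permute.
Variables (d : nat).
Implicit Types s t : 'S_d.

Definition permt (T : Type) s (x : d.-tuple T) : d.-tuple T := [tuple tnth x (s i) | i < d].

Lemma permtM (T : Type) s t (x : d.-tuple T) : permt s (permt t x) = permt (s * t)%g x.
Proof. by apply: eq_from_tnth => i; rewrite !tnth_mktuple permM. Qed.

Lemma permt1 (T : Type) (x : d.-tuple T) : permt 1 x = x.
Proof. by apply: eq_from_tnth => i; rewrite tnth_mktuple perm1. Qed.

Lemma permtVK (T : Type) s (x : d.-tuple T) : permt s^-1 (permt s x) = x.
Proof. by rewrite permtM mulVg permt1. Qed.

Lemma permt_tpermK (T : Type) i j (x : d.-tuple T) :
  permt (tperm i j) (permt (tperm i j) x) = x.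
Proof. by rewrite permtM tperm2 permt1. Qed.

Lemma perm_permt (T : eqType) s (x : d.-tuple T) : perm_eq (permt s x) x.
Proof. by rewrite perm_sym; apply/tuple_permP; exists s^-1%g; rewrite -{1}(permtVK s x). Qed.

Lemma permt_fix (T : Type) i j (x : d.-tuple T) :
  tnth x i = tnth x j -> permt (tperm i j) x = x.
Proof.
by move=> e; apply: eq_from_tnth => k; rewrite tnth_mktuple; case: tpermP => // ->.
Qed.

Lemma tperm_conj (i j k l : 'I_d) : i != j -> k != l ->
  exists r, tperm k l = (r^-1 * tperm i j * r)%g.
Proof.
(* The first factor sends [i] to [k]; the second sends the image of [j] to [l] and fixes [k]. *)
move=> ij kl; exists (tperm i k * tperm (tperm i k j) l)%g.
have -> : forall r t : 'S_d, (r^-1 * t * r = t ^ r)%g by move=> r t; rewrite conjgE mulgA.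
rewrite tpermJ !permM (tpermL i k) (tpermL (tperm i k j) l).
have jk : tperm i k j != k by rewrite -[X in _ != X](tpermL i k) (inj_eq perm_inj) eq_sym.
by rewrite (@tpermD _ _ l) // eq_sym.
Qed.

End Permute.

(** * Functions of four words invariant along both sides of the graph *)

Section Invariance.
Variables (d : nat) (T : Type).
Implicit Types a b c e : d.-tuple bool.
Variable F : d.-tuple bool -> d.-tuple bool -> d.-tuple bool -> d.-tuple bool -> T.
Hypothesis FL : forall s t a b c e,
  F (permt s a) (permt t b) (permt s c) (permt t e) = F a b c e.
Hypothesis FR : forall s t a b c e,
  F (permt s a) (permt t b) (permt t c) (permt s e) = F a b c e.

Let FL1 s a b c e : F (permt s a) b (permt s c) e = F a b c e.
Proof. by rewrite -(FL s 1 a b c e) !permt1. Qed.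
Let FR1 s a b c e : F (permt s a) b c (permt s e) = F a b c e.
Proof. by rewrite -(FR s 1 a b c e) !permt1. Qed.

(* Conjugating a move on the words [a], [c] by a move on [a], [e] only affects
   its action on [a]. *)
Lemma invariant_conj r s a b c e :
  F (permt (r^-1 * s * r)%g a) b (permt s c) e = F a b c e.
Proof.
by rewrite -!permtM -{1}(permtVK r e) FR1 FL1 FR1.
Qed.

Lemma invariant_tperm i j k l a b c e : i != j -> k != l ->
  F (permt (tperm i j) a) b (permt (tperm k l) c) e = F a b c e.
Proof. by move=> ij kl; have [r ->] := tperm_conj kl ij; apply: invariant_conj. Qed.

Section Swap.
Variables (k l : 'I_d).
Hypothesis kl : k != l.
Let sw (o : bool) := permt (if o then tperm k l else 1%g) : d.-tuple bool -> d.-tuple bool.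

Let swD o o' c : sw o (sw o' c) = sw (o (+) o') c.
Proof. by rewrite /sw; case: o; case: o'; rewrite ?permt_tpermK ?permt1. Qed.

(** Each transposition in a factorisation of [s] is traded for [tperm k l] on [c], so only the sign
    of [s] survives. *)
Lemma invariant_fst s a b c e : F (permt s a) b c e = F a b (sw (odd_perm s) c) e.
Proof.
have [ts -> ok] := prod_tpermP s.
elim: ts ok a c => [|[i j] ts IH] /=.
  by rewrite big_nil odd_perm1 => _ a c; rewrite /sw !permt1.
case/andP=> ij ok a c; rewrite big_cons -permtM odd_permM odd_tperm ij.
by rewrite -{1}(permt_tpermK k l c) (invariant_tperm _ _ _ _ ij kl) IH // (swD _ true) addbC.
Qed.

Lemma invariant_perm (s1 s2 s3 s4 : 'S_d) a b c e :
  F (permt s1 a) (permt s2 b) (permt s3 c) (permt s4 e) =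
  F a b (sw (s1 (+) s2 (+) s3 (+) s4) c) e.
Proof.
(* Undoing the moves on [c] and [b] by [FL], then what is left on [e] by [FR1], gathers everything
   on [a]. *)
rewrite -(FL s3^-1 s2^-1) !permtVK !permtM -(FR1 (s2^-1 * s4)^-1).
rewrite !permtVK permtM invariant_fst; congr (F _ _ (sw _ _) _).
by rewrite !odd_permM !odd_permV odd_permM odd_permV; do 4!case: odd_perm.
Qed.
End Swap.

Lemma invariant_even (s1 s2 s3 s4 : 'S_d) a b c e :
  s1 (+) s2 (+) s3 (+) s4 = false ->
  F (permt s1 a) (permt s2 b) (permt s3 c) (permt s4 e) = F a b c e.
Proof.
move=> ev; have [d1|dgt1] := leqP d 1.
  (* No transposition exists here to carry the sign, but all permutations are trivial. *)
  have triv (s : 'S_d) (x : d.-tuple bool) : permt s x = x.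
    apply: eq_from_tnth => i; rewrite tnth_mktuple; congr tnth; apply: ord_inj.
    by have := ltn_ord i; have := ltn_ord (s i); lia.
  by rewrite !triv.
have dgt0 := ltnW dgt1.
rewrite (@invariant_perm (Ordinal dgt0) (Ordinal dgt1)) // ev permt1 //.
Qed.

(** A transposition of two equal letters fixes the word and is odd, so it corrects the total sign
    when needed. *)
Lemma invariant_counts a b c e a' b' c' e' :
  perm_eq a' a -> perm_eq b' b -> perm_eq c' c -> perm_eq e' e ->
  [\/ ~~ injectiveb (tnth a), ~~ injectiveb (tnth b),
      ~~ injectiveb (tnth c) | ~~ injectiveb (tnth e)] ->
  F a' b' c' e' = F a b c e.
Proof.
move=> /tuple_permP[s1 ea] /tuple_permP[s2 eb] /tuple_permP[s3 ec] /tuple_permP[s4 ee] rep.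
have -> : a' = permt s1 a by apply: val_inj.
have -> : b' = permt s2 b by apply: val_inj.
have -> : c' = permt s3 c by apply: val_inj.
have -> : e' = permt s4 e by apply: val_inj.
have [ev|od] := boolP (s1 (+) s2 (+) s3 (+) s4); last exact/invariant_even/negbTE.
have fix_ x : ~~ injectiveb (tnth x) ->
    exists2 t : 'S_d, permt t x = x & odd_perm t.
  case/injectivePn => i [j ij eij].
  by exists (tperm i j); [apply: permt_fix | rewrite odd_tperm].
case: rep => /fix_[t tx ot]; rewrite -{1}tx permtM; apply: invariant_even;
  rewrite odd_permM ot; move: ev; do 4!case: odd_perm => //.
Qed.

End Invariance.

(** * Counts of ones and the exceptional orbit in length two *)

Section BoolWords.
Variable d : nat.
Implicit Types a b c e : d.-tuple bool.

Definition ones a := \sum_(i < d) (tnth a i : nat).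
Definition both a c := \sum_(i < d) (tnth a i && tnth c i : nat).

Lemma ones_permt s a : ones (permt s a) = ones a.
Proof.
rewrite /ones [RHS](reindex_inj (@perm_inj _ s)) /=.
by apply: eq_bigr => i _; rewrite tnth_mktuple.
Qed.

Lemma both_permt s a c : both (permt s a) (permt s c) = both a c.
Proof.
rewrite /both [RHS](reindex_inj (@perm_inj _ s)) /=.
by apply: eq_bigr => i _; rewrite !tnth_mktuple.
Qed.

Lemma ones_count a : ones a = count id a.
Proof. by rewrite -sum1_count big_tuple [RHS]big_mkcond; apply: eq_bigr => i _ /=; case: (tnth _ _). Qed.

Lemma ones_le a : ones a <= d.
Proof. by rewrite ones_count -{2}(size_tuple a) count_size. Qed.

Lemma ones_perm_eq a a' : ones a = ones a' -> perm_eq a a'.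
Proof.
rewrite !ones_count => eq1; apply/allP => x _ /=; apply/eqP.
have [] := (count_predC id a, count_predC id a'); rewrite !size_tuple.
case: x => H H'.
  by rewrite -[RHS](eq_count (a1 := id)) -?eq1; [apply: eq_count; case | case].
have E s : count_mem false s = count (predC id) s by apply: eq_count; case.
by rewrite !E; lia.
Qed.

(** Tells apart the two orbits of quadruples without repeated letters for [d = 2]. Counting common
    ones makes invariance under the moves on [a], [c] and on [b], [e] immediate. *)
Definition exceptional a b c e :=
  [&& d == 2, ones a == 1, ones b == 1, ones c == 1, ones e == 1
    & odd (both a c + both b e)].

Lemma exceptional_permt s t a b c e :
  exceptional (permt s a) (permt t b) (permt s c) (permt t e) = exceptional a b c e.
Proof. by rewrite /exceptional !ones_permt !both_permt. Qed.

End BoolWords.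

Lemma ones2 (a : 2.-tuple bool) : ones a = tnth a ord0 + tnth a ord_max.
Proof. by rewrite /ones !big_ord_recl big_ord0 addn0; congr (_ + tnth a _); apply: val_inj. Qed.

Lemma both2 (a c : 2.-tuple bool) :
  both a c = (tnth a ord0 && tnth c ord0) + (tnth a ord_max && tnth c ord_max).
Proof.
rewrite /both !big_ord_recl big_ord0 addn0.
by congr (_ + (tnth a _ && tnth c _)); apply: val_inj.
Qed.

(** With a single one in each word, [both a c] is 1 or 0 according to whether the first letters of
    [a] and [c] agree. This form is symmetric in the four words, so [c] and [e] may be exchanged. *)
Lemma exceptional2 (a b c e : 2.-tuple bool) :
  ones a = 1 -> ones b = 1 -> ones c = 1 -> ones e = 1 ->
  exceptional a b c e = tnth a ord0 (+) tnth b ord0 (+) tnth c ord0 (+) tnth e ord0.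
Proof.
move=> a1 b1 c1 e1; rewrite /exceptional a1 b1 c1 e1 /= !both2.
move: a1 b1 c1 e1; rewrite !ones2.
by do 8!case: (tnth _ _).
Qed.

Lemma exceptional_swap d (a b c e : d.-tuple bool) :
  exceptional a b e c = exceptional a b c e.
Proof.
have [d2|d2] := eqVneq d 2; last by rewrite /exceptional (negbTE d2).
subst d.
have [a1|] := eqVneq (ones a) 1; last by rewrite /exceptional => /negbTE ->.
have [b1|] := eqVneq (ones b) 1; last by rewrite /exceptional => /negbTE ->; rewrite !andbF.
have [c1|] := eqVneq (ones c) 1; last by rewrite /exceptional => /negbTE ->; rewrite !andbF.
have [e1|] := eqVneq (ones e) 1; last by rewrite /exceptional => /negbTE ->; rewrite !andbF.
by rewrite !exceptional2 // addbAC.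
Qed.

Lemma tnth0_permt2 (s : 'S_2) (a : 2.-tuple bool) : ones a = 1 ->
  tnth (permt s a) ord0 = tnth a ord0 (+) s.
Proof.
rewrite ones2 tnth_mktuple.
have [s0|s1] : s = 1%g \/ s = tperm ord0 ord_max.
- have dec (i : 'I_2) : i = ord0 \/ i = ord_max.
    by case: i => -[|[|//]] p; [left|right]; apply: val_inj.
  have ne : ord0 != ord_max :> 'I_2 by [].
  case: (dec (s ord0)) => e0; [left|right]; apply/permP => i.
  + rewrite perm1; case: (dec i) => -> //.
    by case: (dec (s ord_max)) => // e1; move: ne; rewrite -(inj_eq (@perm_inj _ s)) e0 e1.
  + case: (dec i) => ->; rewrite ?tpermL ?tpermR //.
    by case: (dec (s ord_max)) => // e1; move: ne; rewrite -(inj_eq (@perm_inj _ s)) e0 e1.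
- by rewrite s0 perm1 odd_perm1 addbF.
- by rewrite s1 tpermL odd_tperm /=; do 2!case: (tnth _ _).
Qed.

Lemma injectiveb2_ones (a : 2.-tuple bool) : injectiveb (tnth a) -> ones a = 1.
Proof.
by move/injectiveP/(_ ord0 ord_max); rewrite ones2; do 2!case: (tnth _ _) => //; move=> /(_ erefl).
Qed.

(** With a repeated letter the counts alone decide. Otherwise the length is at most 2, and in length
    2 equality of [exceptional] makes the total sign even. *)
Lemma invariant_key d T (F : d.-tuple bool -> d.-tuple bool -> d.-tuple bool -> d.-tuple bool -> T) :
  (forall s t a b c e, F (permt s a) (permt t b) (permt s c) (permt t e) = F a b c e) ->
  (forall s t a b c e, F (permt s a) (permt t b) (permt t c) (permt s e) = F a b c e) ->
  forall a b c e a' b' c' e',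
  ones a' = ones a -> ones b' = ones b -> ones c' = ones c -> ones e' = ones e ->
  exceptional a' b' c' e' = exceptional a b c e ->
  F a' b' c' e' = F a b c e.
Proof.
move=> FL FR a b c e a' b' c' e' ea eb ec ee ex.
have pa := ones_perm_eq ea; have pb := ones_perm_eq eb.
have pc := ones_perm_eq ec; have pe := ones_perm_eq ee.
have IC := invariant_counts FL FR pa pb pc pe.
have [ia|] := boolP (injectiveb (tnth a)); last by move=> H; apply: IC; constructor 1.
have [ib|] := boolP (injectiveb (tnth b)); last by move=> H; apply: IC; constructor 2.
have [ic|] := boolP (injectiveb (tnth c)); last by move=> H; apply: IC; constructor 3.
have [ie|] := boolP (injectiveb (tnth e)); last by move=> H; apply: IC; constructor 4.
have [d1|d2] := leqP d 1.
  by congr F; apply: val_inj; apply: perm_small_eq; rewrite ?size_tuple.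
have : d <= 2 by have := leq_card _ (injectiveP _ ia); rewrite card_ord card_bool.
rewrite leq_eqVlt ltnNge d2 orbF => /eqP d2e {d2 IC}; subst d.
move: pa pb => /tuple_permP[s1 pa] /tuple_permP[s2 pb].
move: pc pe => /tuple_permP[s3 pc] /tuple_permP[s4 pe].
have {}pa : a' = permt s1 a by apply: val_inj.
have {}pb : b' = permt s2 b by apply: val_inj.
have {}pc : c' = permt s3 c by apply: val_inj.
have {}pe : e' = permt s4 e by apply: val_inj.
have [a1 b1] := (injectiveb2_ones ia, injectiveb2_ones ib).
have [c1 e1] := (injectiveb2_ones ic, injectiveb2_ones ie).
move: ex; rewrite !exceptional2 ?ea ?eb ?ec ?ee // pa pb pc pe !tnth0_permt2 // => ex.
apply: (invariant_even FL FR); move: ex.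
by do 4!case: (tnth _ _); do 4!case: (odd_perm _).
Qed.

(** * The rank of the incidence matrix of a bipartite graph *)

Section IncidenceRank.
Variables (K : fieldType) (W L R C : finType).
Variables (l : W -> L) (r : W -> R) (cL : L -> C) (cR : R -> C) (s : C -> L).
Local Open Scope ring_scope.

Definition incidence : 'M[K]_(#|W|, #|L| + #|R|) :=
  row_mx (\matrix_(i, j) (l (enum_val i) == enum_val j)%:R)
         (\matrix_(i, j) (r (enum_val i) == enum_val j)%:R).

Hypothesis cLR : forall w, cL (l w) = cR (r w).
Hypothesis sK : cancel s cL.
Hypothesis r_onto : forall v, exists w, r w = v.
(** Connectedness in terms of functions instead of paths: the form that the kernel computation uses
    and that invariance provides. *)
Hypothesis connected : forall f g,
  (forall w, f (l w) + g (r w) = 0 :> K) -> forall u u', cL u = cL u' -> f u = f u'.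

(** Signed indicator functions of the components, a basis of the kernel. *)
Let classes : 'M[K]_(#|C|, #|L| + #|R|) :=
  row_mx (\matrix_(k, j) (cL (enum_val j) == enum_val k)%:R)
         (\matrix_(k, j) - (cR (enum_val j) == enum_val k)%:R).

Let sum_delta (I : finType) (F : I -> K) x : \sum_(j < #|I|) F (enum_val j) * (x == enum_val j)%:R = F x.
Proof.
rewrite (bigD1 (enum_rank x)) //= enum_rankK eqxx mulr1 big1 ?addr0 // => j ne.
case: eqP => [ex|_]; last by rewrite mulr0.
by rewrite ex enum_valK eqxx in ne.
Qed.

Let mul_incidence_tr m (y : 'M[K]_(m, #|L| + #|R|)) i w :
  (y *m incidence^T) i (enum_rank w) =
  lsubmx y i (enum_rank (l w)) + rsubmx y i (enum_rank (r w)).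
Proof.
rewrite -{1}(hsubmxK y) /incidence tr_row_mx mul_row_col mxE; congr (_ + _); rewrite mxE.
  rewrite -(sum_delta (fun u => lsubmx y i (enum_rank u))).
  by apply: eq_bigr => j _; rewrite [_^T _ _]mxE [X in _ * X]mxE enum_valK enum_rankK.
rewrite -(sum_delta (fun u => rsubmx y i (enum_rank u))).
by apply: eq_bigr => j _; rewrite [_^T _ _]mxE [X in _ * X]mxE enum_valK enum_rankK.
Qed.

(* The left kernel of the transposed incidence matrix of a bipartite graph
   consists of the functions that are constant on each connected component, up
   to a change of sign between the two sides. *)
Lemma rank_incidence : (\rank incidence + #|C| = #|L| + #|R|)%N.
Proof.
have free : row_free classes.
  apply/row_freeP; exists (col_mx (\matrix_(j, k) (s (enum_val k) == enum_val j)%:R) 0).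
  rewrite mul_row_col mulmx0 addr0; apply/matrixP => k k'; rewrite !mxE.
  under eq_bigr do rewrite !mxE.
  rewrite (sum_delta (fun u => (cL u == enum_val k)%:R)) sK.
  by rewrite (inj_eq enum_val_inj) eq_sym.
suff -> : #|C| = (\rank (kermx incidence^T)).
  by rewrite mxrank_ker mxrank_tr subnKC // rank_leq_col.
rewrite -(eqP free); apply/eqmx_rank/andP; split.
  apply/sub_kermxP/matrixP => k i; rewrite -(enum_valK i) mul_incidence_tr.
  by rewrite /classes row_mxKl row_mxKr !mxE !enum_rankK cLR subrr.
apply/row_subP => i; have : row i (kermx incidence^T) *m incidence^T = 0.
  by rewrite -row_mul mulmx_ker row0.
move: (row i _) => y /matrixP y0.
pose f u := lsubmx y 0 (enum_rank u); pose g v := rsubmx y 0 (enum_rank v).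
have fg w : f (l w) + g (r w) = 0.
  by rewrite /f /g -mul_incidence_tr y0 mxE.
apply/submxP; exists (\row_k f (s (enum_val k))).
rewrite -(hsubmxK y) /classes mul_mx_row; congr row_mx; apply/rowP => j; rewrite [RHS]mxE.
  under eq_bigr do rewrite !mxE.
  rewrite (sum_delta (fun k => f (s k))).
  transitivity (f (enum_val j)); first by rewrite /f enum_valK.
  by apply: (connected fg); rewrite sK.
under eq_bigr do rewrite !mxE mulrN.
rewrite sumrN (sum_delta (fun k => f (s k))).
transitivity (g (enum_val j)); first by rewrite /g enum_valK.
have [w <-] := r_onto (enum_val j); rewrite -cLR.
rewrite (connected fg (u := s _) (u' := l w)) ?sK //.
by apply/eqP; rewrite -addr_eq0 addrC fg.
Qed.

End IncidenceRank.

(** * Words and the graph they form *)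

Lemma letter_subproof (x y : bool) : 2 * x + y < 4.
Proof. by case: x; case: y. Qed.
(** Pairs of bits serve both as letters of words and as row or column indices of 4 by 4 matrices. *)
Definition letter x y : 'I_4 := Ordinal (letter_subproof x y).
Definition bit1 (k : 'I_4) := 1 < k.
Definition bit2 (k : 'I_4) := odd k.

Lemma bit1_letter x y : bit1 (letter x y) = x.
Proof. by case: x; case: y. Qed.
Lemma bit2_letter x y : bit2 (letter x y) = y.
Proof. by case: x; case: y. Qed.
Lemma letter_bits k : letter (bit1 k) (bit2 k) = k.
Proof. by apply: val_inj; case: k => -[|[|[|[|]]]]. Qed.

Section Words.
Variable d : nat.
Implicit Types (x y : d.-tuple 'I_4) (a b c e : d.-tuple bool).

(* A word of length [d] over the letters [abce] in [{0,1}^4], stored as the word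
   of its [ac] parts and the word of its [be] parts. *)
Definition word := (d.-tuple 'I_4 * d.-tuple 'I_4)%type.

Definition bits1 x : d.-tuple bool := [tuple bit1 (tnth x i) | i < d].
Definition bits2 x : d.-tuple bool := [tuple bit2 (tnth x i) | i < d].
Definition letters a c : d.-tuple 'I_4 := [tuple letter (tnth a i) (tnth c i) | i < d].

Definition mkword a b c e : word := (letters a c, letters b e).
(** Exchanges [c] and [e], hence the roles of the two Segre cones. *)
Definition swap (w : word) : word :=
  mkword (bits1 w.1) (bits1 w.2) (bits2 w.2) (bits2 w.1).

Lemma bits1_letters a c : bits1 (letters a c) = a.
Proof. by apply: eq_from_tnth => i; rewrite !tnth_mktuple bit1_letter. Qed.
Lemma bits2_letters a c : bits2 (letters a c) = c.
Proof. by apply: eq_from_tnth => i; rewrite !tnth_mktuple bit2_letter. Qed.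
Lemma letters_bits x : letters (bits1 x) (bits2 x) = x.
Proof. by apply: eq_from_tnth => i; rewrite !tnth_mktuple letter_bits. Qed.

Lemma mkword_bits (w : word) : mkword (bits1 w.1) (bits1 w.2) (bits2 w.1) (bits2 w.2) = w.
Proof. by rewrite /mkword !letters_bits -surjective_pairing. Qed.

Lemma swap_mkword a b c e : swap (mkword a b c e) = mkword a b e c.
Proof. by rewrite /swap /= !bits1_letters !bits2_letters. Qed.

Lemma swapK : involutive swap.
Proof. by move=> w; rewrite -[w in RHS]mkword_bits /swap /= !bits1_letters !bits2_letters. Qed.

Lemma permt_letters s a c : permt s (letters a c) = letters (permt s a) (permt s c).
Proof. by apply: eq_from_tnth => i; rewrite !tnth_mktuple. Qed.

(** A multiset of letters, in the form counted by [card_sorted_tuples]. *)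
Definition sorted_word := {x : d.-tuple 'I_4 | x \in [set t : d.-tuple 'I_4 | sorted leq (map val t)]}.

Let leI (i j : 'I_4) := i <= j.

Lemma sort_word_subproof x :
  [tuple of sort leI x] \in [set t : d.-tuple 'I_4 | sorted leq (map val t)].
Proof.
rewrite inE sorted_map; apply: (@sort_sorted _ leI).
by move=> i j; apply: leq_total.
Qed.

Definition sort_word x : sorted_word := Sub [tuple of sort leI x] (sort_word_subproof x).

Lemma sort_word_perm x : perm_eq (val (sort_word x)) x.
Proof. by rewrite SubK perm_sort. Qed.

Lemma sort_wordP x y : reflect (sort_word x = sort_word y) (perm_eq x y).
Proof.
have P : reflect (sort leI x = sort leI y) (perm_eq x y).
  apply: perm_sortP => [i j|j i k|i j].
  - exact: leq_total.
  - exact: leq_trans.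
  - by move=> H; apply: val_inj; apply: anti_leq.
apply: (iffP P) => [e|e]; first by do 2!apply: val_inj.
exact: (congr1 (fun u : sorted_word => val (val u)) e).
Qed.

Lemma val_sort_word (u : sorted_word) : sort_word (val u) = u.
Proof.
do 2!apply: val_inj; rewrite /=; apply: sorted_sort; first by move=> i j k; apply: leq_trans.
by have := valP u; rewrite inE sorted_map.
Qed.

Lemma sort_permt s x : sort_word (permt s x) = sort_word x.
Proof. exact/sort_wordP/perm_permt. Qed.

Lemma card_sorted_word : #|{: sorted_word}| = 'C(d + 3, 3).
Proof.
rewrite card_sig /= (eq_card (B := [set t : d.-tuple 'I_4 | sorted leq (map val t)])) //.
by rewrite card_sorted_tuples -bin_sub ?leq_addr // addKn.
Qed.

(** One type for both sides of the graph: on the left the multisets of [ac] and [be] letters, on the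
    right those of [ae] and [bc] letters. A word is the edge joining its two vertices. *)
Definition vertex := (sorted_word * sorted_word)%type.
Definition left (w : word) : vertex := (sort_word w.1, sort_word w.2).
Definition right (w : word) : vertex := left (swap w).
Definition vword (u : vertex) : word := (val u.1, val u.2).

Lemma vwordK : cancel vword left.
Proof. by case=> u v; rewrite /left /= !val_sort_word. Qed.

End Words.

(** * The connected components and their number *)

Section Classes.
Variable d : nat.
Implicit Types (a b c e : d.-tuple bool) (w : word d) (u v : vertex d).

Definition threshold n : d.-tuple bool := [tuple (i < n)%N | i < d].

Lemma ones_threshold n : n <= d -> ones (threshold n) = n.
Proof.
move=> nd; rewrite /ones; under eq_bigr do rewrite tnth_mktuple.
suff -> : forall m, \sum_(i < m) (i < n : nat) = minn m n by lia.
by elim=> [|m IH]; rewrite ?big_ord0 ?big_ord_recr /= ?IH; lia.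
Qed.

Definition key := (('I_d.+1 * 'I_d.+1 * 'I_d.+1 * 'I_d.+1) * bool)%type.

Definition key_ones : 'I_d.+1 * 'I_d.+1 * 'I_d.+1 * 'I_d.+1 :=
  (inord 1, inord 1, inord 1, inord 1).

(** The boolean marks the second component, which exists only for [d = 2] and all counts equal to
    1. *)
Definition valid_key (k : key) := k.2 ==> (d == 2) && (k.1 == key_ones).

Definition key_of a b c e : key :=
  ((inord (ones a), inord (ones b), inord (ones c), inord (ones e)), exceptional a b c e).

Lemma key_of_valid a b c e : valid_key (key_of a b c e).
Proof.
apply/implyP => /= /and5P[-> /eqP-> /eqP-> /eqP->] /andP[/eqP-> _]; exact: eqxx.
Qed.

Lemma key_of_inj a b c e a' b' c' e' : key_of a b c e = key_of a' b' c' e' ->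
  [/\ ones a = ones a', ones b = ones b', ones c = ones c', ones e = ones e'
    & exceptional a b c e = exceptional a' b' c' e'].
Proof.
have I x y : x <= d -> y <= d -> inord x = inord y :> 'I_d.+1 -> x = y.
  by move=> xd yd /(congr1 val); rewrite /= !inordK.
move=> E; split; last exact: (congr1 (fun k : key => k.2) E).
- exact: I (ones_le _) (ones_le _) (congr1 (fun k : key => k.1.1.1.1) E).
- exact: I (ones_le _) (ones_le _) (congr1 (fun k : key => k.1.1.1.2) E).
- exact: I (ones_le _) (ones_le _) (congr1 (fun k : key => k.1.1.2) E).
- exact: I (ones_le _) (ones_le _) (congr1 (fun k : key => k.1.2) E).
Qed.

Definition class w : {k | valid_key k} :=
  Sub (key_of (bits1 w.1) (bits1 w.2) (bits2 w.1) (bits2 w.2)) (key_of_valid _ _ _ _).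

Lemma class_mkword a b c e : val (class (mkword a b c e)) = key_of a b c e.
Proof. by rewrite SubK /= !bits1_letters !bits2_letters. Qed.

Lemma bits1_permt s (x : d.-tuple 'I_4) : bits1 (permt s x) = permt s (bits1 x).
Proof. by apply: eq_from_tnth => i; rewrite !tnth_mktuple. Qed.

Lemma bits2_permt s (x : d.-tuple 'I_4) : bits2 (permt s x) = permt s (bits2 x).
Proof. by apply: eq_from_tnth => i; rewrite !tnth_mktuple. Qed.

Lemma class_permt s t w : class (permt s w.1, permt t w.2) = class w.
Proof.
apply: val_inj; rewrite /= /key_of !bits1_permt !bits2_permt.
by rewrite exceptional_permt !ones_permt.
Qed.

Lemma class_swap w : val (class (swap w)) =
  (let: (x, y, z, t, o) := val (class w) in (x, y, t, z, o)).
Proof. by rewrite class_mkword /= /key_of exceptional_swap. Qed.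

Lemma vword_left w : exists s t, vword (left w) = (permt s w.1, permt t w.2).
Proof.
case: w => x y; rewrite /vword /left /=.
have /tuple_permP[s es] := sort_word_perm x; have /tuple_permP[t et] := sort_word_perm y.
by exists s, t; congr pair; apply: val_inj.
Qed.

Lemma class_vword_left w : class (vword (left w)) = class w.
Proof. by have [s [t ->]] := vword_left w; apply: class_permt. Qed.

End Classes.

Lemma class_onto d (k : {k : key d | valid_key k}) : exists w, class w == k.
Proof.
suff [a [b [c [e kE]]]] : exists a b c e, key_of a b c e = val k.
  by exists (mkword a b c e); rewrite -val_eqE class_mkword kE.
case: k => -[[[[x y] z] t] o] /= ok.
have ones_ (n : 'I_d.+1) : inord (ones (threshold d n)) = n.
  by apply: val_inj; rewrite /= inordK ones_threshold ?ltn_ord // -ltnS.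
have [d2|d2] := eqVneq d 2; last first.
  exists (threshold _ x), (threshold _ y), (threshold _ z), (threshold _ t).
  rewrite /key_of !ones_ /exceptional (negbTE d2).
  by move: ok; rewrite /valid_key (negbTE d2) /=; case: o.
subst d; case: o ok => ok; last first.
  exists (threshold _ x), (threshold _ y), (threshold _ z), (threshold _ t).
  rewrite /key_of !ones_; congr pair.
  have [ex|/negbTE //] := boolP (exceptional _ _ _ _).
  case/and5P: (ex) => _ /eqP ea /eqP eb /eqP ec /andP[/eqP ee _].
  rewrite exceptional2 // !tnth_mktuple in ex.
  have o_ (n : 'I_3) : ones (threshold 2 n) = n by apply: ones_threshold; rewrite -ltnS.
  by rewrite !o_ in ea eb ec ee; rewrite ea eb ec ee in ex.
have /= /eqP[-> -> -> ->] := ok.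
(* Three words beginning with their single one and a fourth ending with it: the parity of first
   letters is odd. *)
pose a := threshold 2 1; pose e : 2.-tuple bool := [tuple (0 < i)%N | i < 2].
have a1 : ones a = 1 by rewrite ones_threshold.
have e1 : ones e = 1 by rewrite ones2 !tnth_mktuple.
exists a, a, a, e; rewrite /key_of a1 e1; congr pair.
by rewrite exceptional2 // !tnth_mktuple.
Qed.

Lemma card_valid_key d : #|{: {k : key d | valid_key k}}| = d.+1 ^ 4 + (d == 2).
Proof.
rewrite card_sig.
have -> : #|[pred k : key d | valid_key k]| =
   #|[set (x, false) | x in [set: 'I_d.+1 * 'I_d.+1 * 'I_d.+1 * 'I_d.+1]] :|:
     (if d == 2 then [set (key_ones d, true)] else set0)|.
  apply: eq_card => -[x o]; rewrite !inE /valid_key /=.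
  case: o => /=.
    have -> : ((x, true) \in [set (x, false) | x in [set: 'I_d.+1 * 'I_d.+1 * 'I_d.+1 * 'I_d.+1]]) = false.
      by apply/imsetP => -[].
    by case: (d == 2); rewrite !inE // xpair_eqE andbT.
  by rewrite imset_f ?inE.
rewrite cardsU card_imset; last by move=> x y [].
rewrite cardsT !card_prod !card_ord.
rewrite (_ : _ :&: _ = set0) ?cards0 ?subn0; last first.
  apply/setP => -[x o]; rewrite !inE; apply/negP => /andP[/imsetP[y _ [_ ->]]].
  by case: (d == 2); rewrite ?inE ?xpair_eqE ?andbF.
by congr (_ + _); [lia | case: (d == 2); rewrite ?cards1 ?cards0].
Qed.

Lemma rank_word_incidence d (K : fieldType) :
  \rank (incidence K (@left d) (@right d)) + (d.+1 ^ 4 + (d == 2)) = 2 * 'C(d + 3, 3) ^ 2.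
Proof.
rewrite -card_valid_key (@rank_incidence _ _ _ _ _ _ _ (fun u => class (vword u))
  (fun v => class (swap (vword v))) (fun k => left (xchoose (class_onto k)))).
- by rewrite !card_prod !card_sorted_word; lia.
- move=> w; apply: val_inj.
  by rewrite class_vword_left class_swap class_vword_left class_swap; case: (val _) => -[[[]]].
- by move=> k; rewrite class_vword_left; apply/eqP/(xchooseP (class_onto k)).
- by move=> v; exists (swap (vword v)); rewrite /right swapK vwordK.
move=> f g fg u u' /(congr1 val) eq_class.
pose F a b c e := f (left (mkword a b c e)).
have E u0 : f u0 = F (bits1 (vword u0).1) (bits1 (vword u0).2)
                     (bits2 (vword u0).1) (bits2 (vword u0).2).
  by rewrite /F mkword_bits vwordK.
have [? ? ? ? ?] := key_of_inj eq_class.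
rewrite !E; apply: invariant_key => // s t a b c e.
  by rewrite /F /left /= -!permt_letters !sort_permt.
(* Along an edge [f] is minus [g] at the right end, so [F] depends only on the multisets of [ae] and
   [bc] letters: the second invariance. *)
have F_opp a' b' c' e' : F a' b' c' e' = (- g (left (mkword a' b' e' c')))%R.
  by apply/eqP; rewrite -addr_eq0 -swap_mkword fg.
by rewrite !F_opp /left /= -!permt_letters !sort_permt.
Qed.

Local Open Scope ring_scope.

(** * Null frames of the determinant form *)

Section Wedge.
Variable F : fieldType.
Implicit Types x y u v t : bool -> F.

Definition wedge x y := x false * y true - x true * y false.

(** The Levi-Civita symbol in two indices. *)
Definition epsilon (a b : bool) : F := (~~ a && b)%:R - (a && ~~ b)%:R.

Definition det2 (p : bool -> bool -> F) :=
  p false false * p true true - p false true * p true false.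

(* The polar form of the determinant: [polar m m] is twice [det m]. *)
Definition polar (m n : bool -> bool -> F) :=
  m false false * n true true + m true true * n false false
  - m false true * n true false - m true false * n false true.

Lemma polar_rank1 x y u v :
  polar (fun a b => x a * y b) (fun a b => u a * v b) = wedge x u * wedge y v.
Proof. by rewrite /polar /wedge; ring. Qed.

Lemma wedge_eq0 x u t : wedge x u = 0 -> wedge x t != 0 -> exists k, forall a, u a = k * x a.
Proof.
move=> xu xt; exists (wedge u t / wedge x t) => a; rewrite mulrAC; apply: canRL (mulfK xt) _.
(* The linear relation among three vectors of the plane. *)
suff -> : u a * wedge x t = wedge u t * x a + t a * wedge x u by rewrite xu mulr0 addr0.
by rewrite /wedge; case: a; ring.
Qed.

Lemma det0_rank1 (n : bool -> bool -> F) :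
  n false false * n true true = n false true * n true false ->
  exists x y, forall a b, n a b = x a * y b.
Proof.
move=> det0.
have [n00|n00] := eqVneq (n false false) 0; last first.
  exists (fun a => n a false / n false false), (n false); case=> b; last by rewrite divff ?mul1r.
  case: b; last by rewrite divfK.
  by rewrite mulrAC; apply: (canRL (mulfK n00)); rewrite mulrC det0 mulrC.
rewrite n00 mul0r in det0; move/esym/eqP: det0; rewrite mulf_eq0 => /orP[]/eqP z.
  exists (fun a => a%:R), (n true); case=> b; rewrite ?mul1r ?mul0r //.
  by case: b.
exists (fun a => n a true), (fun b => b%:R) => a b; case: b; rewrite ?mulr1 ?mulr0 //.
by case: a.
Qed.

Lemma null_frame_parallel (x y u v u' v' x' y' : bool -> F) :
  wedge x u' * wedge y v' = 0 -> wedge x' u * wedge y' v = 0 -> wedge x' u' * wedge y' v' = 0 ->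
  wedge x x' * wedge y y' = 1 -> wedge u u' * wedge v v' = -1 ->
  wedge x u = 0 ->
  exists p q : bool -> bool -> F,
    [/\ forall a b, x a * y b = p a false * q b false,
        forall a b, u a * v b = p a false * q b true,
        forall a b, u' a * v' b = p a true * q b false
      & forall a b, x' a * y' b = p a true * q b true].
Proof.
move=> xu'yv' x'uy'v x'u'y'v' xx'yy' uu'vv' xu.
have nz (s t z : F) : s * t = z -> z != 0 -> s != 0 /\ t != 0.
  by move=> <-; rewrite mulf_eq0 negb_or => /andP.
have [xx' yy'] := nz _ _ _ xx'yy' (oner_neq0 F).
have N1 : (-1 : F) != 0 by rewrite oppr_eq0 oner_neq0.
have [uu' vv'] := nz _ _ _ uu'vv' N1.
have wN s t : wedge s t = - wedge t s by rewrite /wedge; ring.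
have y'y : wedge y' y != 0 by rewrite wN oppr_eq0.
have x'x : wedge x' x != 0 by rewrite wN oppr_eq0.
have wZl k s t t' : (forall a, s a = k * t a) -> wedge s t' = k * wedge t t'.
  by move=> e; rewrite /wedge !e; ring.
have wZr k s t t' : (forall a, s a = k * t a) -> wedge t' s = k * wedge t' t.
  by move=> e; rewrite /wedge !e; ring.
have [k uE] := wedge_eq0 xu xx'.
have [k0 xu'] := nz _ _ _ (esym (wZl _ _ _ u' uE)) uu'.
have y'v : wedge y' v = 0.
  move/eqP: x'uy'v; rewrite (wZr _ _ _ _ uE) !mulf_eq0 (negbTE k0) (negbTE x'x) => /eqP //.
have [l vE] := wedge_eq0 y'v y'y.
have yv' : wedge y v' = 0.
  by move/eqP: xu'yv'; rewrite mulf_eq0 (negbTE xu') => /eqP.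
have [m v'E] := wedge_eq0 yv' yy'.
have [m0 _] := nz _ _ _ (esym (wZr _ _ _ v v'E)) vv'.
have x'u' : wedge x' u' = 0.
  move/eqP: x'u'y'v'; rewrite (wZr _ _ _ y' v'E) !mulf_eq0 (negbTE m0) (negbTE y'y) !orbF => /eqP //.
have [r u'E] := wedge_eq0 x'u' x'x.
have klmr : m * r * (k * l) = 1.
  move: uu'vv'; rewrite (wZl _ _ _ _ uE) (wZr _ _ _ _ u'E) (wZl _ _ _ _ vE) (wZr _ _ _ _ v'E).
  move=> e; rewrite -[LHS]mulr1 -{1}xx'yy'; apply: oppr_inj; rewrite -e (wN y' y); ring.
exists (fun a b => if b then m * r * x' a else x a), (fun a b => if b then k * l * y' a else y a).
split=> a b //=; rewrite ?uE ?vE ?u'E ?v'E; try ring.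
by rewrite mulrACA klmr mul1r.
Qed.

(** Each slice in [a], [b] is isotropic, hence of rank one. Orthogonality of the first two slices
    makes their left or their right factors parallel; the two cases are the two rulings of the
    quadric. *)
Lemma null_frame (z : bool -> bool -> bool -> bool -> F) : 2%:R != 0 :> F ->
  (forall c e c' e', polar (fun a b => z a b c e) (fun a b => z a b c' e')
                     = epsilon c c' * epsilon e e') ->
  exists p q : bool -> bool -> F,
    (forall a b c e, z a b c e = p a c * q b e) \/
    (forall a b c e, z a b c e = p a e * q b c).
Proof.
move=> nz2 zP.
have R1 c e : exists x y : bool -> F, forall a b, z a b c e = x a * y b.
  apply: det0_rank1; apply: (mulfI nz2).
  have h : polar (fun a b => z a b c e) (fun a b => z a b c e) = 0.
    by rewrite zP /epsilon andbN andNb subrr mul0r.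
  by apply/eqP; rewrite -subr_eq0 -h /polar; apply/eqP; ring.
have [x [y N00]] := R1 false false; have [u [v N01]] := R1 false true.
have [u' [v' N10]] := R1 true false; have [x' [y' N11]] := R1 true true.
have P c e c' e' s t s' t' : (forall a b, z a b c e = s a * t b) ->
    (forall a b, z a b c' e' = s' a * t' b) ->
    wedge s s' * wedge t t' = epsilon c c' * epsilon e e'.
  by move=> e1 e2; rewrite -zP -polar_rank1 /polar !e1 !e2.
have := P _ _ _ _ _ _ _ _ N00 N01; have := P _ _ _ _ _ _ _ _ N00 N10.
have := P _ _ _ _ _ _ _ _ N00 N11; have := P _ _ _ _ _ _ _ _ N01 N10.
have := P _ _ _ _ _ _ _ _ N11 N01; have := P _ _ _ _ _ _ _ _ N11 N10.
rewrite /epsilon /= !(subr0, sub0r, mulr0, mul0r, mulr1, mul1r).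
move=> h1 h2 h3 h4 h5 h6; move/eqP: (h6); rewrite mulf_eq0 => /orP[]/eqP w0.
  have [p [q [E00 E01 E10 E11]]] := null_frame_parallel h5 h2 h1 h4 h3 w0.
  by exists p, q; left => a b [] []; rewrite (N00, N01, N10, N11) (E00, E01, E10, E11).
(* In the other ruling the two tensor factors exchange roles. *)
rewrite mulrC in h1; rewrite mulrC in h2; rewrite mulrC in h3.
rewrite mulrC in h4; rewrite mulrC in h5.
have [q [p [E00 E01 E10 E11]]] := null_frame_parallel h5 h2 h1 h4 h3 w0.
by exists p, q; right => a b [] []; rewrite (N00, N01, N10, N11) mulrC (E00, E01, E10, E11) mulrC.
Qed.
End Wedge.

(** * Orthogonal matrices in determinant coordinates *)

Lemma square_root (F : closedFieldType) (x : F) : exists y, y ^+ 2 = x.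
Proof.
have [y yE] := @solve_monicpoly F 2 (fun i => if i == 0%N then x else 0) isT.
by exists y; rewrite yE !big_ord_recl big_ord0 /= expr0 mulr1 mul0r !addr0.
Qed.

Lemma sum_letter (V : nmodType) (f : 'I_4 -> V) :
  \sum_k f k = f (letter false false) + f (letter false true)
             + f (letter true false) + f (letter true true).
Proof.
rewrite !big_ord_recl big_ord0 addr0 !addrA.
by congr (f _ + f _ + f _ + f _); apply: val_inj.
Qed.

Section Coordinates.
Variable F : closedFieldType.
Hypothesis nz2 : 2%:R != 0 :> F.

(** The Gram matrix of [polar], with 2 by 2 matrices flattened by [letter]. *)
Definition det_form : 'M[F]_4 :=
  \matrix_(r, s) (epsilon F (bit1 r) (bit1 s) * epsilon F (bit2 r) (bit2 s)).

Lemma det_coordinates : exists U V : 'M[F]_4,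
  [/\ U *m V = 1%:M, V *m U = 1%:M & U^T *m det_form *m U = 2%:M].
Proof.
have [i i2] := square_root (-1 : F).
(* The entries of the 2 by 2 matrix of a quaternion, with rows [x0 + i x1, - x2 - i x3] and
   [x2 - i x3, x0 - i x1]; its determinant is the sum of the four squares. *)
pose U : 'M[F]_4 := \matrix_(r, s) nth 0 (nth [::]
  [:: [:: 1; i; 0; 0]; [:: 0; 0; - 1; - i]; [:: 0; 0; 1; - i]; [:: 1; - i; 0; 0]] r) s.
have UE : U^T *m det_form *m U = 2%:M.
  apply/matrixP => r s; rewrite mxE sum_letter !mxE !sum_letter !mxE /epsilon /=.
  case: r => -[|[|[|[|//]]]] ?; case: s => -[|[|[|[|//]]]] ? /=; rewrite ?mulr1n ?mulr0n; ring: i2.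
have VU : (2%:R^-1 *: (U^T *m det_form)) *m U = 1%:M.
  by rewrite -scalemxAl UE -mul_scalar_mx -scalar_mxM mulVf.
exists U, (2%:R^-1 *: (U^T *m det_form)); split=> //.
exact: mulmx1C.
Qed.

Variables U V : 'M[F]_4.
Hypotheses (UV : U *m V = 1%:M) (VU : V *m U = 1%:M).
Hypothesis UJ : U^T *m det_form *m U = 2%:M.

Definition zcoord (M : 'M[F]_4) a b c e := (U *m M *m V) (letter a b) (letter c e).

Lemma gram_V : V^T *m V = 2%:R^-1 *: det_form.
Proof.
have -> : det_form = V^T *m (U^T *m det_form *m U) *m V.
  by rewrite !mulmxA -trmx_mul UV trmx1 mul1mx -mulmxA UV mulmx1.
by rewrite UJ mul_mx_scalar -scalemxAl scalerA mulVf // scale1r.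
Qed.

Lemma gram_letter (Z : 'M[F]_4) c e c' e' :
  (Z^T *m det_form *m Z) (letter c e) (letter c' e') =
  polar (fun a b => Z (letter a b) (letter c e)) (fun a b => Z (letter a b) (letter c' e')).
Proof.
rewrite mxE sum_letter !mxE !sum_letter !mxE /epsilon /= /polar.
ring.
Qed.

(** In these coordinates an orthogonal matrix is an isometry of [det_form], so its columns form a
    null frame. *)
Lemma orthogonal_zcoord (k : F) (M : 'M[F]_4) : M^T *m M = 1%:M ->
  exists p q : bool -> bool -> F,
    (forall a b c e, zcoord (k *: M) a b c e = p a c * q b e) \/
    (forall a b c e, zcoord (k *: M) a b c e = p a e * q b c).
Proof.
move=> MO; pose Z := U *m M *m V.
have ZJ : Z^T *m det_form *m Z = det_form.
  rewrite /Z !trmx_mul !mulmxA -2!(mulmxA (V^T *m M^T)).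
  rewrite UJ mul_mx_scalar -!scalemxAl -(mulmxA V^T) MO mulmx1 gram_V.
  by rewrite scalerA mulfV // scale1r.
have [|p [q pq]] := @null_frame F (fun a b c e => Z (letter a b) (letter c e)) nz2.
  by move=> c e c' e'; rewrite -gram_letter ZJ mxE !bit1_letter !bit2_letter.
exists (fun a c => k * p a c), q.
have E a b c e : zcoord (k *: M) a b c e = k * Z (letter a b) (letter c e).
  by rewrite /zcoord -scalemxAr -scalemxAl mxE.
by case: pq => H; [left|right] => a b c e; rewrite E H mulrA.
Qed.

(** Division by a square root of the multiplier [k] turns the conformal [Z] into an isometry. *)
Lemma conformal_zcoord (Z : 'M[F]_4) (k : F) : k != 0 ->
  Z^T *m det_form *m Z = k *: det_form ->
  exists (c : F) (M : 'M[F]_4), M^T *m M = 1%:M /\ U *m (c *: M) *m V = Z.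
Proof.
move=> k0 ZJ; have [c cE] := square_root k.
have c0 : c != 0 by apply: contraNneq k0 => c0; rewrite -cE c0 expr0n.
exists c, (c^-1 *: (V *m Z *m U)); split; last first.
  by rewrite scalerA divff // scale1r !mulmxA UV mul1mx -mulmxA UV mulmx1.
have gram : (V *m Z *m U)^T *m (V *m Z *m U) = k%:M.
  have -> : (V *m Z *m U)^T *m (V *m Z *m U) = U^T *m (Z^T *m (V^T *m V) *m Z) *m U.
    by rewrite !trmx_mul !mulmxA.
  rewrite gram_V -scalemxAr -scalemxAl ZJ scalerA -scalemxAr -scalemxAl UJ.
  by rewrite -mul_scalar_mx -scalar_mxM mulrAC mulVf // mul1r.
rewrite [_^T](_ : _ = c^-1 *: (V *m Z *m U)^T); last by apply/matrixP => r s; rewrite !mxE.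
rewrite -scalemxAl -scalemxAr scalerA gram -mul_scalar_mx -scalar_mxM -cE.
by congr (_%:M); field.
Qed.

(** Both kinds of tensor multiply [det_form] by [det2 p * det2 q]; [twist] chooses the Segre
    cone. *)
Lemma zcoord_onto (p q : bool -> bool -> F) (twist : bool) :
  det2 p * det2 q != 0 ->
  exists (k : F) (M : 'M[F]_4), M^T *m M = 1%:M /\
  forall a b c e, zcoord (k *: M) a b c e =
    if twist then p a e * q b c else p a c * q b e.
Proof.
move=> nz; pose Z : 'M[F]_4 := \matrix_(r, s)
  let: (a, b, c, e) := (bit1 r, bit2 r, bit1 s, bit2 s) in
  if twist then p a e * q b c else p a c * q b e.
have ZJ : Z^T *m det_form *m Z = (det2 p * det2 q) *: det_form.
  apply/matrixP => r s; rewrite -(letter_bits r) -(letter_bits s) gram_letter !mxE.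
  rewrite !(bit1_letter, bit2_letter) /polar !mxE !(bit1_letter, bit2_letter) /det2 /epsilon.
  case: (twist); case: (bit1 r); case: (bit2 r); case: (bit1 s); case: (bit2 s) => /=; ring.
have [k [M [MO ME]]] := conformal_zcoord nz ZJ.
by exists k, M; split=> // a b c e; rewrite /zcoord ME mxE !(bit1_letter, bit2_letter).
Qed.

End Coordinates.

(** * Independence of monomials on a Segre cone *)

Lemma digits_lt B (f : nat -> nat) n :
  (forall k, f k < B)%N -> (\sum_(k < n) f k * B ^ k < B ^ n)%N.
Proof.
move=> fB; elim: n => [|n IH]; first by rewrite big_ord0 expn0.
rewrite big_ord_recr /= expnS; apply: leq_trans (_ : f n * B ^ n + B ^ n <= _)%N.
  by rewrite addnC ltn_add2l.
by rewrite -mulSnr leq_mul2r fB orbT.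
Qed.

Lemma divmod_inj m q r q' r' :
  (r < m -> r' < m -> r + q * m = r' + q' * m -> r = r' /\ q = q')%N.
Proof.
move=> rm r'm E; have m0 : (0 < m)%N by lia.
have := congr1 (modn^~ m) E; have := congr1 (divn^~ m) E.
by rewrite /= ![(_ + _ * m)%N]addnC !divnMDl // !modnMDl !modn_small // !divn_small // !addn0.
Qed.

Lemma digits_inj B (f g : nat -> nat) n :
  (forall k, f k < B)%N -> (forall k, g k < B)%N ->
  (\sum_(k < n) f k * B ^ k = \sum_(k < n) g k * B ^ k)%N ->
  forall k, (k < n)%N -> f k = g k.
Proof.
move=> fB gB; elim: n => [|n IH] //; rewrite !big_ord_recr /= => E k.
have [E1 E2] := divmod_inj (digits_lt n fB) (digits_lt n gB) E.
by rewrite ltnS leq_eqVlt => /orP[/eqP->|/(IH E1)].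
Qed.

Lemma poly_eq0_horner (F : fieldType) (p : {poly F}) :
  injective (fun n => n%:R : F) -> (forall t, p.[t] = 0) -> p = 0.
Proof.
move=> inj p0; apply/eqP/negPn/negP => pn0.
have := max_poly_roots (rs := [seq n%:R | n <- iota 0 (size p)]) pn0.
rewrite size_map size_iota ltnn map_inj_uniq ?iota_uniq // => H; suff: false by [].
by apply: H => //; apply/allP => t _; rewrite rootE p0.
Qed.

Section WordWeights.
Variable d : nat.
Implicit Types w : word d.

Section Eval.
Variable F : fieldType.
Implicit Types p q : bool -> bool -> F.

Definition word_eval p q w :=
  (\prod_(i < d) p (bit1 (tnth w.1 i)) (bit2 (tnth w.1 i))) *
  (\prod_(i < d) q (bit1 (tnth w.2 i)) (bit2 (tnth w.2 i))).

Lemma word_eval_left p q w : word_eval p q (vword (left w)) = word_eval p q w.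
Proof.
rewrite /word_eval /=; congr (_ * _).
  rewrite -(big_tuple _ _ (val (sort_word w.1)) xpredT (fun x => p (bit1 x) (bit2 x))).
  by rewrite (perm_big _ (sort_word_perm _)) big_tuple.
rewrite -(big_tuple _ _ (val (sort_word w.2)) xpredT (fun x => q (bit1 x) (bit2 x))).
by rewrite (perm_big _ (sort_word_perm _)) big_tuple.
Qed.
End Eval.

(** Exceeds every multiplicity and is at least 2 even for [d = 0], which keeps [D] below nonzero. *)
Let B := d.+2.
Let weight1 (x : d.-tuple 'I_4) := (\sum_(i < d) B ^ (tnth x i))%N.
(** Its eight digits in base [B] are the multiplicities of the letters in the two words. *)
Definition weight w := (weight1 w.1 + weight1 w.2 * B ^ 4)%N.

Let count_nat (x : d.-tuple 'I_4) k := count_mem k (map val x).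

Let count_lt x k : (count_nat x k < B)%N.
Proof.
rewrite /count_nat /B ltnS ltnW // ltnS; apply: leq_trans (count_size _ _) _.
by rewrite size_map size_tuple.
Qed.

Let weight1_digits x : weight1 x = (\sum_(k < 4) count_nat x k * B ^ k)%N.
Proof.
rewrite /weight1 -(big_tuple _ _ x xpredT (fun l : 'I_4 => B ^ l)%N).
rewrite (partition_big id xpredT) //=; apply: eq_bigr => k _.
rewrite (eq_bigr (fun=> B ^ k)%N) => [|i /eqP->//].
rewrite big_const_seq iter_addn_0 mulnC; congr (_ * _)%N.
by rewrite /count_nat count_map; apply: eq_count.
Qed.

Let weight1_inj x y : weight1 x = weight1 y -> sort_word x = sort_word y.
Proof.
rewrite !weight1_digits => E; apply/sort_wordP/allP => k _ /=; apply/eqP.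
have := digits_inj (count_lt x) (count_lt y) E (ltn_ord k).
by rewrite /count_nat !count_map; congr (_ = _); apply: eq_count.
Qed.

Lemma weight_inj w w' : weight w = weight w' -> left w = left w'.
Proof.
have lt x : (weight1 x < B ^ 4)%N by rewrite weight1_digits digits_lt.
by move/(divmod_inj (lt _) (lt _)) => [/weight1_inj e1 /weight1_inj e2]; rewrite /left e1 e2.
Qed.

Lemma weight_left w : weight (vword (left w)) = weight w.
Proof.
suff E x : weight1 (val (sort_word x)) = weight1 x by rewrite /weight /= !E.
rewrite !weight1_digits; apply: eq_bigr => k _; congr (_ * _)%N.
by rewrite /count_nat; apply/seq.permP/perm_map/sort_word_perm.
Qed.

Variable F : fieldType.
Hypothesis natr_inj : injective (fun n => n%:R : F).

(* Substituting [t ^ B ^ k] for the variables gives distinct powers of [t] to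
   distinct monomials. *)
Lemma word_eval_inj (c : word d -> F) :
  (forall p q, det2 p * det2 q != 0 -> \sum_w c w * word_eval p q w = 0) ->
  forall u, \sum_(w | left w == u) c w = 0.
Proof.
move=> c0 u.
pose P : {poly F} := \sum_w c w *: 'X^(weight w).
(* This is [det2 p * det2 q] after the substitution. Where it vanishes the hypothesis gives nothing
   on [P], but [P * D] vanishes anyway. *)
pose D : {poly F} := ('X^(1 + B ^ 3) - 'X^(B + B ^ 2)) *
                     ('X^(B ^ 4 + B ^ 7) - 'X^(B ^ 5 + B ^ 6)).
have PD : P * D = 0.
  apply: (poly_eq0_horner natr_inj) => t; rewrite hornerM.
  pose p a c := t ^+ (B ^ letter a c); pose q a c := t ^+ (B ^ (4 + letter a c)).
  have DE : D.[t] = det2 p * det2 q.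
    by rewrite /D /det2 /p /q hornerM !hornerD !hornerN !hornerXn -!exprD.
  have [->|nz] := eqVneq D.[t] 0; first by rewrite mulr0.
  rewrite DE in nz; rewrite [P.[t]](_ : _ = 0) ?mul0r // -(c0 _ _ nz) horner_sum.
  apply: eq_bigr => w _; rewrite hornerZ hornerXn; congr (_ * _).
  rewrite /weight exprD /weight1 big_distrl /= -!prodrXr /word_eval; congr (_ * _).
    by apply: eq_bigr => i _; rewrite /p letter_bits.
  by apply: eq_bigr => i _; rewrite /q letter_bits expnD mulnC.
have XX i j : i != j -> 'X^i - 'X^j != 0 :> {poly F}.
  move=> ij; apply/negP => /eqP/(congr1 (fun r : {poly F} => r`_i)) /eqP.
  by rewrite coefB !coefXn eqxx (negbTE ij) subr0 coef0 oner_eq0.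
have D0 : D != 0.
  rewrite mulf_neq0 // XX //; first by rewrite /B; lia.
  rewrite (_ : B ^ 4 + B ^ 7 = B ^ 4 * (1 + B ^ 3))%N; last by rewrite mulnDr muln1 -expnD.
  rewrite (_ : B ^ 5 + B ^ 6 = B ^ 4 * (B + B ^ 2))%N; last by rewrite mulnDr -expnSr -expnD.
  by rewrite eqn_pmul2l ?expn_gt0 // /B; lia.
have {D0 PD}P0 : P = 0 by move/eqP: PD; rewrite mulf_eq0 (negbTE D0) orbF => /eqP.
have := congr1 (fun r : {poly F} => r`_(weight (vword u))) P0.
rewrite coef0 coef_sum => E0; rewrite -[RHS]E0 big_mkcond; apply: eq_bigr => w _.
rewrite coefZ coefXn; have [<-|ne] := eqVneq (left w) u.
  by rewrite weight_left eqxx mulr1.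
rewrite (_ : (_ == _) = false) ?mulr0 //; apply/eqP => /esym/weight_inj E.
by rewrite E vwordK eqxx in ne.
Qed.

End WordWeights.

(** * Word monomials on the cone *)

Lemma natr_CC_inj : injective (fun n => n%:R : CC).
Proof.
move=> m n /= E; apply/eqP.
by rewrite -(@eqr_nat (Rdefinitions.R)[i]); apply/eqP.
Qed.

Lemma two_CC : 2%:R != 0 :> CC.
Proof. by apply/eqP => /(@natr_CC_inj 2 0). Qed.

Section Monomials.
Variables (U V : 'M[CC]_4).
Hypotheses (UV : U *m V = 1%:M) (VU : V *m U = 1%:M).
Hypothesis UJ : U^T *m det_form CC *m U = 2%:M.
Variable d : nat.

(** The linear form [Z_(ab)(ce)], with [x] encoding [ac] and [y] encoding [be]. *)
Definition coord (x y : 'I_4) : Pol :=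
  \sum_r \sum_s (U (letter (bit1 x) (bit1 y)) r * V s (letter (bit2 x) (bit2 y)))
                  *: 'X_(mxvec_index r s).

Lemma coordE x y M :
  (coord x y).@[mxpt M] = zcoord U V M (bit1 x) (bit1 y) (bit2 x) (bit2 y).
Proof.
rewrite /coord raddf_sum /zcoord mxE /=.
under eq_bigr do rewrite raddf_sum /=.
rewrite exchange_big /=; apply: eq_bigr => s _; rewrite mxE big_distrl; apply: eq_bigr => r _ /=.
by rewrite mevalZ mevalXU /mxpt mxvecE mulrAC.
Qed.

Lemma coord_homog x y : coord x y \is 1.-homog.
Proof.
rewrite /coord; apply: rpred_sum => r _; apply: rpred_sum => s _; apply: rpredZ.
by rewrite dhomogX; apply/eqP; exact: mdeg1.
Qed.

(** All reorderings of a word give the same monomial; their rows in the incidence matrix coincide,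
    so the rank is unaffected. *)
Definition word_monomial (w : word d) : Pol :=
  \prod_(i < d) coord (tnth w.1 i) (tnth w.2 i).

Lemma prod_homog n (f : 'I_n -> Pol) :
  (forall i, f i \is 1.-homog) -> \prod_i f i \is n.-homog.
Proof.
elim: n f => [|n IH] f f1; first by rewrite big_ord0 dhomog1.
by rewrite big_ord_recl; apply: (dhomogM (f1 _) (IH _ _)) => i; apply: f1.
Qed.

Lemma word_monomialE w M p q (twist : bool) :
  (forall a b c e, zcoord U V M a b c e = if twist then p a e * q b c else p a c * q b e) ->
  (word_monomial w).@[mxpt M] = word_eval p q (if twist then swap w else w).
Proof.
move=> zE; rewrite rmorph_prod /word_eval -big_split; apply: eq_bigr => i _ /=.
rewrite coordE zE; case: twist {zE} => //=.
by rewrite !tnth_mktuple !bit1_letter !bit2_letter.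
Qed.

Lemma entry_coord (M : 'M[CC]_4) r s :
  M r s = \sum_x \sum_y V r (letter (bit1 x) (bit1 y)) * U (letter (bit2 x) (bit2 y)) s
                         * (coord x y).@[mxpt M].
Proof.
under eq_bigr do under eq_bigr do rewrite coordE /zcoord.
have {1}-> : M = V *m (U *m M *m V) *m U by rewrite !mulmxA VU mul1mx -mulmxA VU mulmx1.
move: (U *m M *m V) => Z.
rewrite mxE !sum_letter !mxE !sum_letter !bit1_letter !bit2_letter; ring.
Qed.

Definition spanned (f : 'M[CC]_4 -> CC) :=
  exists c : word d -> CC, forall M, f M = \sum_w c w * (word_monomial w).@[mxpt M].

Lemma spanned_sum (I : eqType) (s : seq I) (f : I -> 'M[CC]_4 -> CC) (k : I -> CC) :
  (forall i, i \in s -> spanned (f i)) -> spanned (fun M => \sum_(i <- s) k i * f i M).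
Proof.
elim: s => [|i s IH] sp.
  by exists (fun=> 0) => M; rewrite big_nil big1 // => w _; rewrite mul0r.
have [c cE] := sp i (mem_head _ _).
have [|c' c'E] := IH; first by move=> j js; apply: sp; rewrite inE js orbT.
exists (fun w => k i * c w + c' w) => M.
rewrite big_cons cE c'E big_distrr -big_split; apply: eq_bigr => w _ /=.
by rewrite mulrA -mulrDl.
Qed.

Lemma spanned_prod (t : d.-tuple 'I_16) : spanned (fun M => \prod_i mxpt M (tnth t i)).
Proof.
have [co coE] : exists co : 'I_16 -> 'I_4 * 'I_4 -> CC,
    forall k M, mxpt M k = \sum_xy co k xy * (coord xy.1 xy.2).@[mxpt M].
  suff /fin_all_exists[co coE] : forall k : 'I_16, exists co : 'I_4 * 'I_4 -> CC,
    forall M, mxpt M k = \sum_xy co xy * (coord xy.1 xy.2).@[mxpt M] by exists co.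
  move=> k; case/mxvec_indexP: (k : 'I_(4 * 4)) => r s.
  exists (fun xy => V r (letter (bit1 xy.1) (bit1 xy.2)) * U (letter (bit2 xy.1) (bit2 xy.2)) s) => M.
  by rewrite /mxpt mxvecE entry_coord pair_big.
exists (fun w => \prod_i co (tnth t i) (tnth w.1 i, tnth w.2 i)) => M.
under eq_bigr do rewrite coE.
(* Expanding the product chooses a pair of letters at each position, that is, a word. *)
rewrite bigA_distr_bigA /=.
pose h (w : word d) : {ffun 'I_d -> 'I_4 * 'I_4} := [ffun i => (tnth w.1 i, tnth w.2 i)].
pose h' (f : {ffun 'I_d -> 'I_4 * 'I_4}) : word d :=
  ([tuple (f i).1 | i < d], [tuple (f i).2 | i < d]).
rewrite (reindex h); last first.
  exists h' => [w|f] _; last by apply/ffunP => i; rewrite ffunE !tnth_mktuple -surjective_pairing.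
  by case: w => x y; congr pair; apply: eq_from_tnth => i; rewrite tnth_mktuple ffunE.
apply: eq_bigr => w _; rewrite rmorph_prod -big_split; apply: eq_bigr => i _ /=.
by rewrite ffunE.
Qed.

Lemma spanned_homog (p : Pol) : p \is d.-homog -> spanned (fun M => p.@[mxpt M]).
Proof.
move=> /dhomogP hom.
suff [c cE] : spanned (fun M => \sum_(m <- msupp p) p@_m * \prod_i mxpt M i ^+ m i).
  by exists c => M; rewrite mevalE cE.
apply: spanned_sum => m /hom /=; rewrite mdegE => md.
pose s := flatten [seq nseq (m k) k | k <- enum 'I_16].
have sz : size s == d.
  rewrite size_flatten /shape -map_comp sumnE big_map big_enum /= -md.
  by apply/eqP/eq_bigr => k _; rewrite size_nseq.
have [c cE] := spanned_prod (Tuple sz).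
exists c => M; rewrite -cE -(big_tuple _ _ (Tuple sz) xpredT (mxpt M)) /= big_flatten big_map big_enum.
by apply: eq_bigr => k _; rewrite big_nseq -Monoid.iteropE.
Qed.

Definition coefs (c : word d -> CC) : 'rV[CC]_#|{: word d}| := \row_i c (enum_val i).

Lemma mul_incidence (c : word d -> CC) :
  (coefs c *m incidence CC (@left d) (@right d) = 0) <->
  (forall u, \sum_(w | left w == u) c w = 0) /\ (forall u, \sum_(w | right w == u) c w = 0).
Proof.
have sumE (h : word d -> vertex d) u :
    \sum_(w | h w == u) c w =
    (coefs c *m (\matrix_(i, j) (h (enum_val i) == enum_val j)%:R)) 0 (enum_rank u).
  rewrite mxE big_mkcond (reindex _ (onW_bij _ (enum_val_bij _))) /=.
  by apply: eq_bigr => i _; rewrite !mxE enum_rankK; case: eqP; rewrite ?mulr1 ?mulr0.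
rewrite /incidence mul_mx_row; split.
  rewrite -row_mx0 => /eq_row_mx[l0 r0].
  by split=> u; rewrite sumE ?l0 ?r0 mxE.
case=> l0 r0; rewrite -row_mx0; congr row_mx; apply/rowP => j.
  by rewrite -(enum_valK j) -sumE l0 mxE.
by rewrite -(enum_valK j) -sumE r0 mxE.
Qed.

Lemma word_eval_swap_inj (c : word d -> CC) :
  (forall p q, det2 p * det2 q != 0 -> \sum_w c w * word_eval p q (swap w) = 0) ->
  forall u, \sum_(w | right w == u) c w = 0.
Proof.
move=> c0 u; rewrite (reindex_inj (can_inj (@swapK d))) /=.
under eq_bigl do rewrite /right swapK.
apply: (word_eval_inj natr_CC_inj (c := fun w => c (swap w))) => p q nz.
rewrite -[RHS](c0 p q nz) [RHS](reindex_inj (can_inj (@swapK d))).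
by apply: eq_bigr => w _; rewrite swapK.
Qed.

(** On each Segre cone, words at the same vertex restrict to the same monomial and distinct vertices
    to independent ones. Vanishing there means that the coefficients sum to zero at every vertex. *)
Lemma vanishes_incidence (c : word d -> CC) :
  (forall k M, inO4 M -> \sum_w c w * (word_monomial w).@[mxpt (k *: M)] = 0) <->
  coefs c *m incidence CC (@left d) (@right d) = 0.
Proof.
split=> [c0|/mul_incidence[l0 r0] k M MO].
  apply/mul_incidence; split.
    apply: (word_eval_inj natr_CC_inj) => p q nz.
    have [k [M [MO zE]]] := zcoord_onto two_CC UV UJ false nz.
    by rewrite -[RHS](c0 k M MO); apply: eq_bigr => w _; rewrite (word_monomialE (twist := false) w zE).
  apply: word_eval_swap_inj => p q nz.
  have [k [M [MO zE]]] := zcoord_onto two_CC UV UJ true nz.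
  by rewrite -[RHS](c0 k M MO); apply: eq_bigr => w _; rewrite (word_monomialE (twist := true) w zE).
have [p [q [zE|zE]]] := orthogonal_zcoord two_CC UV UJ k MO.
  under eq_bigr do rewrite (word_monomialE (twist := false) _ zE) -word_eval_left.
  rewrite (partition_big (@left d) xpredT) //= big1 // => u _.
  under eq_bigr => w /eqP-> do [].
  by rewrite -big_distrl /= l0 mul0r.
under eq_bigr do rewrite (word_monomialE (twist := true) _ zE) -word_eval_left.
rewrite (partition_big (@right d) xpredT) //= big1 // => u _.
under eq_bigr => w /eqP E do rewrite -[left _]/(right w) E.
by rewrite -big_distrl /= r0 mul0r.
Qed.

(** The component is the space of coefficient vectors modulo the left kernel of the incidence
    matrix. *)
Lemma dim_component_rank : dim_component d (\rank (incidence CC (@left d) (@right d))).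
Proof.
set Phi := incidence _ _ _.
have coefsK (x : 'rV[CC]_#|{: word d}|) : coefs (fun w => x 0 (enum_rank w)) = x.
  by apply/rowP => i; rewrite mxE enum_valK.
split.
  have /submxP[D DE] : (row_base Phi <= Phi)%MS by rewrite eq_row_base.
  exists (fun i => \sum_w D i (enum_rank w) *: word_monomial w); split.
    move=> i; apply: rpred_sum => w _; apply: rpredZ; apply: prod_homog => j; exact: coord_homog.
  move=> a van; pose ar := \row_i a i.
  suff : ar *m D *m Phi = 0.
    rewrite -mulmxA -DE => /eqP; rewrite mulmx_free_eq0 ?row_base_free // => /eqP/rowP a0 i.
    by have := a0 i; rewrite !mxE.
  rewrite -(coefsK (ar *m D)); apply/vanishes_incidence => k M MO.
  rewrite -[RHS](van k M MO) raddf_sum /=.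
  under [RHS]eq_bigr do rewrite mevalZ raddf_sum big_distrr /=.
  rewrite exchange_big; apply: eq_bigr => w _; rewrite mxE big_distrl; apply: eq_bigr => i _ /=.
  by rewrite mxE mevalZ mulrA.
move=> ps [hom ind].
have /fin_all_exists[c cE] i : exists c : word d -> CC, forall M,
    (ps i).@[mxpt M] = \sum_w c w * (word_monomial w).@[mxpt M] by apply/spanned_homog.
pose C : 'M[CC]_(_, #|{: word d}|) := \matrix_(i, j) c i (enum_val j).
(* One row more than the rank of [Phi] forces a nontrivial relation between the images. *)
have : kermx (C *m Phi) != 0.
  rewrite -mxrank_eq0 mxrank_ker subn_eq0 -ltnNge ltnS.
  exact: mxrankM_maxr.
case/rowV0Pn => v /sub_kermxP vC; case/eqP; apply/rowP => i; rewrite [RHS]mxE.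
apply: ind => k M MO; move: i => _.
move: vC; rewrite mulmxA -(coefsK (v *m C)) => /vanishes_incidence/(_ k M MO) E0.
rewrite -[RHS]E0 raddf_sum /=.
under eq_bigr do rewrite mevalZ cE big_distrr /=.
rewrite exchange_big; apply: eq_bigr => w _; rewrite mxE big_distrl; apply: eq_bigr => i _ /=.
by rewrite mxE enum_rankK mulrA.
Qed.

End Monomials.

(** * The Hilbert polynomial and the numerator *)

Lemma bin3_mul6 d : (6 * 'C(d + 3, 3) = d.+1 * d.+2 * d.+3)%N.
Proof.
have := bin_ffact (d + 3) 3; rewrite !ffactnS ffactn0 (_ : 3`! = 6)%N // mulnC => ->.
rewrite muln1; lia.
Qed.

Definition hilbert_function d := (2 * 'C(d + 3, 3) ^ 2 - (d.+1 ^ 4 + (d == 2)))%N.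

Lemma hilbert_polynomial d :
  (18 * hilbert_function d + (d == 2%N) * 18 =
   d ^ 6 + 12 * d ^ 5 + 40 * d ^ 4 + 72 * d ^ 3 + 85 * d ^ 2 + 60 * d + 18)%N.
Proof.
(* The rank identity shows that the natural subtraction does not truncate. *)
have le : (d.+1 ^ 4 + (d == 2) <= 2 * 'C(d + 3, 3) ^ 2)%N.
  by rewrite -(rank_word_incidence d CC) leq_addl.
have E : (18 * (2 * 'C(d + 3, 3) ^ 2) = (d.+1 * d.+2 * d.+3) ^ 2)%N.
  by rewrite -bin3_mul6; lia.
rewrite /hilbert_function mulnBr E.
suff -> : ((d.+1 * d.+2 * d.+3) ^ 2 =
  d ^ 6 + 12 * d ^ 5 + 40 * d ^ 4 + 72 * d ^ 3 + 85 * d ^ 2 + 60 * d + 18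
  + 18 * d.+1 ^ 4)%N.
  have := le; rewrite -(leq_pmul2l (isT : 0 < 18)%N) E; case: (d == 2); lia.
by rewrite -(addn3 d) -(addn2 d) -(addn1 d); ring.
Qed.

Lemma times_1mt7_add7 (h : nat -> nat) n :
  times_1mt7 h (n + 7)%N =
  (h (n + 7)%N)%:Z - 7%:Z * (h (n + 6)%N)%:Z + 21%:Z * (h (n + 5)%N)%:Z - 35%:Z * (h (n + 4)%N)%:Z
  + 35%:Z * (h (n + 3)%N)%:Z - 21%:Z * (h (n + 2)%N)%:Z + 7%:Z * (h (n + 1)%N)%:Z - (h n)%:Z.
Proof.
rewrite /times_1mt7 (minn_idPl (leq_addl _ _)) !big_ord_recl big_ord0 /= /bump /=.
rewrite -!addnBA // !subSS !subn0 addn0 !addn0 !add1n !exprS expr0.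
rewrite bin0 bin1 binn !(binS _ _) !bin0 !bin1 !bin_small ?addn0 //; ring.
Qed.

Lemma hilbert_numerator d : times_1mt7 hilbert_function d = nth 0 hilb_numer d.
Proof.
have H := hilbert_polynomial.
have [d10|d10] := leqP 10 d.
  (* A seventh difference kills a polynomial of degree 6; from degree 10 on only values at degrees
     at least 3 enter, past the correction at 2. *)
  rewrite nth_default // -(subnK (leq_trans (isT : 7 <= 10)%N d10)) times_1mt7_add7.
  move: (d - 7)%N (leq_sub2r 7 d10) => n n3.
  have := (H n, H (n + 1), H (n + 2), H (n + 3), H (n + 4), H (n + 5), H (n + 6), H (n + 7))%N.
  have E k : (n + k == 2)%N = false by apply/negbTE; lia.
  have E0 : (n == 2)%N = false by apply/negbTE; lia.
  rewrite E0 !E !mul0n !addn0 => -[[[[[[[]]]]]]].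
  have Q x y : (18 * x = y)%N -> 18 * x%:Z = y%:R by move=> <-; rewrite -[x%:Z]natz natrM.
  move=> /Q e0 /Q e1 /Q e2 /Q e3 /Q e4 /Q e5 /Q e6 /Q e7.
  apply: (mulfI (isT : 18%:Z != 0)); rewrite mulr0 !(mulrBr, mulrDr) ![18 * (_ * _)]mulrCA.
  rewrite e0 e1 e2 e3 e4 e5 e6 e7 !(natrD, natrM, natrX); ring.
move: (H 0%N) (H 1%N) (H 2%N) (H 3%N) (H 4%N) (H 5%N) (H 6%N) (H 7%N) (H 8%N) (H 9%N).
move: hilbert_function => h {H} h0 h1 h2 h3 h4 h5 h6 h7 h8 h9.
case: d d10 => [|[|[|[|[|[|[|[|[|[|//]]]]]]]]]] _;
  rewrite ?(times_1mt7_add7 h 0) ?(times_1mt7_add7 h 1) ?(times_1mt7_add7 h 2)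
    ?add0n ?add1n ?add2n /=;
  try rewrite /times_1mt7 /minn !big_ord_recl big_ord0 /= /bump /= ?add1n ?subSS ?subn0
    !(exprS, expr0) !(binS, bin0, bin1) ?bin_small //= ?addn0; lia.
Qed.

(* The Hilbert function h of O(C(O(4))) exists (all components are finite
   dimensional), its Hilbert series satisfies
   H(t) (1-t)^7 = 1+9t+27t^2+19t^3-30t^4+34t^5-35t^6+21t^7-7t^8+t^9,
   and h d = p(d) for d <> 2, h 2 = p(2) - 1 = 118, where
   18 p(d) = d^6 + 12 d^5 + 40 d^4 + 72 d^3 + 85 d^2 + 60 d + 18. *)
Theorem theorem3p5 :
  exists h : nat -> nat,
    (forall d : nat, dim_component d (h d)) /\
    (forall d : nat, times_1mt7 h d = nth 0 hilb_numer d) /\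
    (forall d : nat,
       (18 * h d + (d == 2%N) * 18 =
        d ^ 6 + 12 * d ^ 5 + 40 * d ^ 4 + 72 * d ^ 3 + 85 * d ^ 2 + 60 * d + 18)%N).
Proof.
exists hilbert_function; split; last first.
  by split; [apply: hilbert_numerator | apply: hilbert_polynomial].
move=> d; have [U [V [UV VU UJ]]] := det_coordinates two_CC.
suff -> : hilbert_function d = \rank (incidence CC (@left d) (@right d)).
  exact: (dim_component_rank UV VU UJ).
by rewrite /hilbert_function -(rank_word_incidence d CC) addnK.
Qed.
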